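(* Let $T$ be the real root of $T^3=T^2+T+1$. For all $\omega>0$ (including $\omega\ge1$), $$T_{\mathrm{can}}(\omega)\ \ge\ \tfrac{13}{7}\ =\ T+0.017856\dots .$$ Equality occurs exactly in the limit at the rational corner $(\omega,\alpha,\sigma_2)=\bigl(\tfrac17,\,2,\,\tfrac67\bigr)$, where all four constraints (B1), (B2), (B4), (W) saturate simultaneously: $T_{\mathrm{can}}(\omega)=\tfrac{13}7$ holds only for $\omega=\tfrac17$; for $\omega=\tfrac17$ there are admissible triples $(\alpha,\sigma_1,\sigma_2)$ whose values $\rho$ tend to $\tfrac{13}7$, and along every such family $(\alpha,\sigma_2)\to(2,\tfrac67)$.
   Context: For $\omega>0$, call a triple $(\alpha,\sigma_1,\sigma_2)$ of real numbers admissible at width $\omega$ (a blocking of the canonical template) if $\alpha>1$, $\alpha-\omega\ge1$, $0<\sigma_2\le\sigma_1\le1$, and the following four constraints hold: (B1) disks of radii $\alpha,\sigma_1,\sigma_2$ do not pack in a disk of radius $\alpha+1$ (i.e. closed disks with these radii cannot be positioned inside it with pairwise disjoint interiors); (B2) $\sigma_2\ge1-\omega$; (B4) $\sigma_2\ge\alpha-\omega-1$; (W) $\sigma_1+\sigma_2\le\alpha-\omega$. Define $$\rho=\max\Bigl(\sigma_1+\sigma_2,\ \frac{1+\sigma_1+\sigma_2}{\alpha}\Bigr),$$ and let $T_{\mathrm{can}}(\omega)$ be the infimum of $\rho$ over all triples admissible at width $\omega$ (with $\inf\emptyset=+\infty$). A constraint saturates at a point if the point lies on its boundary; for (B1), this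 means being on the boundary between packable and non-packable triples. *)

(* Defs.v *)
From mathcomp Require Import all_boot all_order all_algebra.
From mathcomp Require Import all_classical all_reals all_analysis.

Set Implicit Arguments.
Unset Strict Implicit.
Unset Printing Implicit Defensive.

Import Order.TTheory GRing.Theory Num.Theory.
Import numFieldNormedType.Exports.

Local Open Scope classical_set_scope.
Local Open Scope ring_scope.

(* The norm that the library puts on [R * R] is the sup norm, hence this
   explicit Euclidean distance.  The product topology is the usual one. *)
Definition eucl_dist {R : realType} (p q : R * R) : R :=
  Num.sqrt ((p.1 - q.1) ^+ 2 + (p.2 - q.2) ^+ 2).

Definition disk {R : realType} (c : R * R) (r : R) : set (R * R) :=
  [set p | eucl_dist c p <= r].

Definition packs3 {R : realType} (r1 r2 r3 r : R) : Prop :=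
  exists c1 c2 c3 : R * R,
    [/\ disk c1 r1 `<=` disk (0, 0) r,
        disk c2 r2 `<=` disk (0, 0) r
      & disk c3 r3 `<=` disk (0, 0) r] /\
    [/\ (disk c1 r1)° `&` (disk c2 r2)° = set0,
        (disk c1 r1)° `&` (disk c3 r3)° = set0
      & (disk c2 r2)° `&` (disk c3 r3)° = set0].

(* A triple [((alpha, sigma1), sigma2)]. *)
Definition triple (R : realType) := (R * R * R)%type.

Definition alpha {R : realType} (t : triple R) : R := t.1.1.
Definition sigma1 {R : realType} (t : triple R) : R := t.1.2.
Definition sigma2 {R : realType} (t : triple R) : R := t.2.

Definition constraint_B1 {R : realType} : set (R * R * R) :=
  [set t | ~ packs3 (alpha t) (sigma1 t) (sigma2 t) (alpha t + 1)].

Definition constraint_B2 {R : realType} (w : R) : set (R * R * R) :=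
  [set t | 1 - w <= sigma2 t].

Definition constraint_B4 {R : realType} (w : R) : set (R * R * R) :=
  [set t | alpha t - w - 1 <= sigma2 t].

Definition constraint_W {R : realType} (w : R) : set (R * R * R) :=
  [set t | sigma1 t + sigma2 t <= alpha t - w].

Definition admissible {R : realType} (w : R) (t : triple R) : Prop :=
  [/\ 1 < alpha t, 1 <= alpha t - w
    & [/\ 0 < sigma2 t, sigma2 t <= sigma1 t & sigma1 t <= 1]] /\
  [/\ constraint_B1 t, constraint_B2 w t, constraint_B4 w t
    & constraint_W w t].

Definition rho {R : realType} (t : triple R) : R :=
  Num.max (sigma1 t + sigma2 t) ((1 + sigma1 t + sigma2 t) / alpha t).

Definition T_can {R : realType} (w : R) : \bar R :=
  ereal_inf [set (rho t)%:E | t in [set t | admissible w t]].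

Definition boundary {T : topologicalType} (A : set T) : set T :=
  closure A `\` A°.

Definition saturates {R : realType} (C : set (R * R * R)) (t : triple R) :
  Prop := boundary C t.

(* Main.v *)
Require Import Defs.
From mathcomp Require Import all_boot all_order all_algebra.
From mathcomp Require Import all_classical all_reals all_analysis.
From mathcomp Require Import ring lra.
Import Order.TTheory GRing.Theory Num.Theory.
Import numFieldNormedType.Exports.
Local Open Scope classical_set_scope.
Local Open Scope ring_scope.

(** Lower bound.  Let the disk of radius [a] sit against the boundary of the
disk of radius [a + 1].  A disk of radius [s <= 1] that touches both of them
on one side of the axis through their centres, and a disk of radius [t <= 1]
that does so on the other side, give a packing as soon as they do not overlap.
With the half-angle parametrization [s = 1 / (1 + u^2)],
[t = 1 / (1 + v^2)], [u, v >= 0] (so [s] is the squared sine of the angle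
whose cotangent is [u]), the non-overlap condition is
[a (a + 1) (u + v)^2 >= 1] ([packs3_of_cot]).  Constraint (B1) thus forces
[m := (u + v)^2] to be less than [1 / (a (a + 1))], and [s + t] exceeds
[1 + 1 / (1 + m)] by a nonnegative term of the order of [u v] ([cot_sumE]).

Without that extra term, [s + t > 2 - 1 / (1 + a + a^2)]
([not_packs3_sum_gt]), which beats [13/7] when [a >= 2].  Constraints (B2)
and (W) give [a >= 1 + s] only, so [a] can fall short of [2] by [1 - s]; but
this costs at most about [0.12 (1 - s)], while [u <= v] turns the extra term
into a gain of at least [1.17 (1 - s)].  So
[s + t > 13/7 + (1 - s)] ([not_packs3_sum_gt_corner]).  The two inequalities
together are quantitative: if [rho <= 13/7 + d] with [d] small, then
[alpha], [sigma2] and the width are all within [20 d] of their values at the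
corner ([admissible_near_corner]).  The bound on [T_can], the uniqueness of
the width [1/7] and the convergence of near-optimal families all follow.

Sharpness.  When [sigma1 = 1], the disks of radii [a] and [1] fill a diameter
of the disk of radius [a + 1], so their position is rigid, and the third disk
fits only if its radius is at most [a (a + 1) / (1 + a (a + 1))]
([packs3_unit_le]).  This radius is [6/7] at [a = 2] and grows with slope less
than [1], so the triples [(2 + e, 1, 6/7 + e)] are not packable; they are
admissible at width [1/7] and [rho = 13/7 + e] there.  The corner itself is
packable, which puts it on the boundary for (B1). *)

(** * Packing three disks in terms of distances between centres *)

Section Plane.
Context {R : realType}.
Implicit Types (p q a b c : R * R) (r k : R).

Lemma eucl_dist_ge0 p q : 0 <= eucl_dist p q.
Proof. exact: sqrtr_ge0. Qed.

Lemma sqr_eucl_dist p q :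
  eucl_dist p q ^+ 2 = (p.1 - q.1) ^+ 2 + (p.2 - q.2) ^+ 2.
Proof. by rewrite sqr_sqrtr // addr_ge0 // sqr_ge0. Qed.

Lemma eucl_dist_le p q r : 0 <= r ->
  (eucl_dist p q <= r) = ((p.1 - q.1) ^+ 2 + (p.2 - q.2) ^+ 2 <= r ^+ 2).
Proof.
by move=> r0; rewrite -sqr_eucl_dist ler_pXn2r // nnegrE eucl_dist_ge0.
Qed.

Lemma eucl_dist_ge p q r : 0 <= r ->
  (r <= eucl_dist p q) = (r ^+ 2 <= (p.1 - q.1) ^+ 2 + (p.2 - q.2) ^+ 2).
Proof.
by move=> r0; rewrite -sqr_eucl_dist ler_pXn2r // nnegrE eucl_dist_ge0.
Qed.

Lemma eucl_distC p q : eucl_dist p q = eucl_dist q p.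
Proof.
by rewrite /eucl_dist -(opprB q.1) -(opprB q.2) !sqrrN.
Qed.

Lemma eucl_dist_triangle a b c :
  eucl_dist a c <= eucl_dist a b + eucl_dist b c.
Proof.
rewrite eucl_dist_le ?addr_ge0 ?eucl_dist_ge0 //.
have := eucl_dist_ge0 a b; have := eucl_dist_ge0 b c.
have := sqr_eucl_dist a b; have := sqr_eucl_dist b c.
move: (eucl_dist a b) (eucl_dist b c) => X Y hY hX Y0 X0.
set dot := (a.1 - b.1) * (b.1 - c.1) + (a.2 - b.2) * (b.2 - c.2).
(* Cauchy-Schwarz, through Lagrange's identity. *)
have CS : dot <= X * Y.
  apply: le_trans (ler_norm _) _.
  rewrite -(ger0_norm (mulr_ge0 X0 Y0)) -ler_sqr ?nnegrE ?normr_ge0 //.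
  rewrite !real_normK ?num_real // exprMn hX hY /dot -subr_ge0.
  rewrite (_ : _ - _ =
    ((a.1 - b.1) * (b.2 - c.2) - (a.2 - b.2) * (b.1 - c.1)) ^+ 2) ?sqr_ge0 //.
  by ring.
rewrite /dot in CS; nra.
Qed.

Definition along a b k : R * R :=
  (a.1 + k * (b.1 - a.1), a.2 + k * (b.2 - a.2)).

Lemma eucl_dist_along a b k : eucl_dist a (along a b k) = `|k| * eucl_dist a b.
Proof.
rewrite /eucl_dist /along /= -sqrtr_sqr -sqrtrM ?sqr_ge0 //.
by congr Num.sqrt; ring.
Qed.

Lemma eucl_dist_along_r a b k :
  eucl_dist (along a b k) b = `|1 - k| * eucl_dist a b.
Proof.
rewrite /eucl_dist /along /= -sqrtr_sqr -sqrtrM ?sqr_ge0 //.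
by congr Num.sqrt; ring.
Qed.

Lemma continuous_eucl_dist c : continuous (eucl_dist c).
Proof.
move=> p; rewrite /eucl_dist.
apply: (@continuous_comp _ _ _ (fun x : R * R =>
  (c.1 - x.1) ^+ 2 + (c.2 - x.2) ^+ 2) Num.sqrt); last exact: sqrt_continuous.
have h1 : {for p, continuous (fun x : R * R => c.1 - x.1)}.
  by apply: cvgB; [exact: cvg_cst | exact: cvg_fst].
have h2 : {for p, continuous (fun x : R * R => c.2 - x.2)}.
  by apply: cvgB; [exact: cvg_cst | exact: cvg_snd].
by apply: cvgD; [exact: (cvgM h1 h1) | exact: (cvgM h2 h2)].
Qed.

Lemma continuous_along a b : continuous (along a b).
Proof.
move=> k.
have affine x y : (x + l * (y - x)) @[l --> k] --> x + k * (y - x).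
  by apply: cvgD; [exact: cvg_cst | apply: cvgM; [exact: cvg_id|exact: cvg_cst]].
exact: (cvg_pair (affine a.1 b.1) (affine a.2 b.2)).
Qed.

(** A point of the interior can be pushed a little further away from [c] inside the
disk, hence is at distance less than [r]. *)
Lemma interior_disk c r p : 0 < r ->
  (disk c r)° p <-> eucl_dist c p < r.
Proof.
move=> r0; split => [hp|hp]; last first.
  have : \forall q \near p, eucl_dist c q < r.
    exact: (@cvgr_lt _ _ _ _ (eucl_dist c) (eucl_dist c p)
              (continuous_eucl_dist c p) r hp).
  by apply: filterS => q /ltW.
have p1 : along c p 1 = p by rewrite /along; case: (p) => x y /=; congr pair; ring.
have : \forall k \near (1 : R), disk c r (along c p k).
  by apply: (continuous_along c p 1); rewrite p1.
case/nbhs_ballP => e /= e0 /(_ (1 + e / 2)).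
rewrite /ball /= opprD addNKr normrN gtr0_norm ?divr_gt0 //.
have -> : e / 2 < e by lra.
rewrite /disk /= eucl_dist_along ger0_norm; last lra.
move=> /(_ isT) h; rewrite ltNge; apply/negP => hr; nra.
Qed.

(** For the direct implication, look at the point of the small disk that is
farthest from the origin; its direction is that of [c], or arbitrary if [c] is
the origin. *)
Lemma disk_sub_disk c r r' : 0 < r ->
  disk c r `<=` disk (0, 0) r' <-> eucl_dist (0, 0) c + r <= r'.
Proof.
move=> r0; split => [sub|h p]; last first.
  rewrite /disk /= => hp; apply: le_trans h.
  by apply: le_trans (eucl_dist_triangle _ c _) _; rewrite lerD2l.
have [d0|d0] := eqVneq (eucl_dist (0, 0) c) 0.
  have c0 : c.1 ^+ 2 + c.2 ^+ 2 = 0.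
    have := sqr_eucl_dist (0, 0) c; rewrite d0 /= !sub0r !sqrrN => <-.
    by rewrite expr0n.
  have [c1 c2] : c.1 = 0 /\ c.2 = 0.
    by split; apply/eqP; rewrite -sqrf_eq0; apply/eqP; nra.
  have /sub : disk c r (r, 0).
    by rewrite /disk /= eucl_dist_le ?(ltW r0) //= c1 c2; nra.
  rewrite /disk /= d0 add0r; apply: le_trans.
  by rewrite eucl_dist_ge ?(ltW r0) //=; nra.
have {}d0 : 0 < eucl_dist (0, 0) c by rewrite lt_def d0 eucl_dist_ge0.
set d := eucl_dist _ _ in d0 *.
have rd0 : 0 < r / d by rewrite divr_gt0.
have rdd : r / d * d = r by rewrite divfK // gt_eqF.
have /sub : disk c r (along (0, 0) c (1 + r / d)).
  rewrite /disk /= eucl_distC eucl_dist_along_r -/d opprD addNKr normrN.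
  by rewrite gtr0_norm // rdd.
rewrite /disk /= eucl_dist_along -/d ger0_norm; last lra.
by rewrite mulrDl mul1r rdd.
Qed.

(** If the centres are too close, the point dividing the segment between them in
the ratio [r1 : r2] is interior to both disks. *)
Lemma disks_disjointP c1 c2 r1 r2 : 0 < r1 -> 0 < r2 ->
  (disk c1 r1)° `&` (disk c2 r2)° = set0 <-> r1 + r2 <= eucl_dist c1 c2.
Proof.
move=> r10 r20; split => [dis|h]; last first.
  apply/seteqP; split=> // p [/(interior_disk _ _ _ r10) h1].
  move=> /(interior_disk _ _ _ r20) h2.
  have := eucl_dist_triangle c1 p c2; rewrite (eucl_distC p); lra.
rewrite leNgt; apply/negP => h.
have r0 : 0 < r1 + r2 by lra.
have k1 : r1 / (r1 + r2) * (r1 + r2) = r1 by rewrite divfK // gt_eqF.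
have k0 : 0 < r1 / (r1 + r2) by rewrite divr_gt0.
set k := r1 / (r1 + r2) in k1 k0.
have k2 : 0 < 1 - k by nra.
have : ((disk c1 r1)° `&` (disk c2 r2)°) (along c1 c2 k); last by rewrite dis.
split; apply/interior_disk => //.
  by rewrite eucl_dist_along gtr0_norm //; nra.
by rewrite eucl_distC eucl_dist_along_r gtr0_norm //; nra.
Qed.

Lemma packs3P (r1 r2 r3 r : R) : 0 < r1 -> 0 < r2 -> 0 < r3 ->
  packs3 r1 r2 r3 r <-> exists c1 c2 c3 : R * R,
    [/\ eucl_dist (0, 0) c1 + r1 <= r, eucl_dist (0, 0) c2 + r2 <= r
      & eucl_dist (0, 0) c3 + r3 <= r] /\
    [/\ r1 + r2 <= eucl_dist c1 c2, r1 + r3 <= eucl_dist c1 c3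
      & r2 + r3 <= eucl_dist c2 c3].
Proof.
move=> h1 h2 h3; split=> -[c1 [c2 [c3 [[a1 a2 a3] [b1 b2 b3]]]]];
  exists c1, c2, c3; split; split;
  by [apply/disk_sub_disk | apply/disks_disjointP].
Qed.

End Plane.

(** * Which triples pack in the disk of radius [a + 1] *)

Section Packing.
Context {R : realType}.
Implicit Types a s t u v : R.

(** The large disk is centred at [(-1, 0)]; the disks of radii [s] and [t] touch
both it and the boundary circle, above and below the axis.  If [s] and [t] are
the squared sines of two angles, then [s - t] and [u s + v t] are the sine of
their sum times the sine and the cosine of their difference.  Hence the sum of
the squares of these two quantities is the squared sine of the sum, that is
[s t (u + v)^2], and the distance condition between the two small disks becomes
the hypothesis on [u + v]. *)
Lemma packs3_of_cot a s t u v : 0 < a -> 0 < s -> 0 < t ->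
    s * (1 + u ^+ 2) = 1 -> t * (1 + v ^+ 2) = 1 ->
  1 <= a * (a + 1) * (u + v) ^+ 2 -> packs3 a s t (a + 1).
Proof.
move=> a0 s0 t0 hs ht hm.
have s1 : s <= 1 by have := sqr_ge0 u; nra.
have t1 : t <= 1 by have := sqr_ge0 v; nra.
have k2 : Num.sqrt (a * (a + 1)) ^+ 2 = a * (a + 1) by rewrite sqr_sqrtr //; nra.
move: (Num.sqrt _ : R) k2 => k k2.
have hu : (u * s) ^+ 2 = s - s ^+ 2.
  by rewrite -{2}(mulr1 s) -hs; ring.
have hv : (v * t) ^+ 2 = t - t ^+ 2.
  by rewrite -{2}(mulr1 t) -ht; ring.
have up (x y : R) : x + (0 - 2 * k * y) ^+ 2 = x + 4 * (a * (a + 1)) * y ^+ 2.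
  by rewrite -k2; ring.
have down (x y : R) : x + (0 - - (2 * k * y)) ^+ 2 = x + 4 * (a * (a + 1)) * y ^+ 2.
  by rewrite -k2; ring.
apply/packs3P => //.
exists (-1, 0), (2 * a * s + s - a - 1, 2 * k * (u * s)),
  (2 * a * t + t - a - 1, - (2 * k * (v * t))).
split; split.
- by rewrite addrC lerD2l eucl_dist_le //=; lra.
- rewrite -lerBrDr eucl_dist_le /=; last lra.
  rewrite up hu.
  by rewrite le_eqVlt; apply/orP; left; apply/eqP; ring.
- rewrite -lerBrDr eucl_dist_le /=; last lra.
  rewrite down hv.
  by rewrite le_eqVlt; apply/orP; left; apply/eqP; ring.
- rewrite eucl_dist_ge /=; last lra.
  rewrite up hu.
  by rewrite le_eqVlt; apply/orP; left; apply/eqP; ring.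
- rewrite eucl_dist_ge /=; last lra.
  rewrite down hv.
  by rewrite le_eqVlt; apply/orP; left; apply/eqP; ring.
(* The squared distance is [(s - t)^2 + 4 a (a + 1) s t (u + v)^2], to be
   compared with [(s + t)^2 = (s - t)^2 + 4 s t]. *)
- rewrite eucl_dist_ge /=; last lra.
  have cot_add : (s - t) ^+ 2 + (u * s + v * t) ^+ 2 = s * t * (u + v) ^+ 2.
    transitivity (s * (t * (1 + v ^+ 2)) + t * (s * (1 + u ^+ 2)) - 2 * s * t
                  + 2 * (u * s) * (v * t)); last by ring.
    by rewrite hs ht [(u * s + _) ^+ 2]sqrrD hu hv; ring.
  have -> : (2 * a * s + s - a - 1 - (2 * a * t + t - a - 1)) ^+ 2 +
      (2 * k * (u * s) - - (2 * k * (v * t))) ^+ 2 =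
    (s - t) ^+ 2 + 4 * (a * (a + 1)) * (s * t * (u + v) ^+ 2).
    rewrite -cot_add.
    transitivity ((2 * a + 1) ^+ 2 * (s - t) ^+ 2 +
      4 * k ^+ 2 * (u * s + v * t) ^+ 2); first by ring.
    by rewrite k2; ring.
  have st0 : 0 < s * t by rewrite mulr_gt0.
  nra.
Qed.

Lemma not_packs3_cot a s t : 0 < a -> 0 < s -> s <= 1 -> 0 < t -> t <= 1 ->
    ~ packs3 a s t (a + 1) ->
  exists u v, [/\ 0 <= u /\ 0 <= v, s = (1 + u ^+ 2)^-1, t = (1 + v ^+ 2)^-1
    & a * (a + 1) * (u + v) ^+ 2 < 1].
Proof.
move=> a0 s0 s1 t0 t1 np.
have cot x : 0 < x -> x <= 1 -> exists2 u : R, 0 <= u & x = (1 + u ^+ 2)^-1.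
  move=> x0 x1; exists (Num.sqrt (x^-1 - 1)); first exact: sqrtr_ge0.
  by rewrite sqr_sqrtr ?subrKC ?invrK // subr_ge0 invf_ge1.
have [u u0 hu] := cot s s0 s1; have [v v0 hv] := cot t t0 t1.
exists u, v; split=> //; rewrite ltNge; apply/negP => hm; apply: np.
apply: (@packs3_of_cot a s t u v) => //.
- by rewrite hu mulVf // gt_eqF // ltr_wpDr ?sqr_ge0.
- by rewrite hv mulVf // gt_eqF // ltr_wpDr ?sqr_ge0.
Qed.

(** [s + t] compared with [1 + 1 / (1 + m)], its value when [u = 0] and [v^2 = m].
The last term is what is gained when both radii are less than 1. *)
Lemma cot_sumE u v : let s := (1 + u ^+ 2)^-1 in let t := (1 + v ^+ 2)^-1 in
  let m := (u + v) ^+ 2 in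
  (s + t) * (1 + m) = 2 + m + u * v * (2 - u * v * (2 + m)) * (s * t).
Proof.
move=> /=; field; apply/andP; split; rewrite gt_eqF // ltr_wpDr ?sqr_ge0 //.
Qed.

(** This is [s + t > 2 - 1 / (1 + a + a^2)]: for [m] below [1 / (a (a + 1))] the
last term of [cot_sumE] is nonnegative. *)
Lemma not_packs3_sum_gt a s t :
    1 <= a -> 0 < s -> s <= 1 -> 0 < t -> t <= 1 ->
    ~ packs3 a s t (a + 1) ->
  1 + 2 * (a * (a + 1)) < (s + t) * (1 + a * (a + 1)).
Proof.
move=> a1 s0 s1 t0 t1 np.
have [|u [v [[u0 v0] hs ht]]] := not_packs3_cot a s t _ s0 s1 t0 t1 np; first lra.
have := cot_sumE u v; rewrite /= -hs -ht.
set m := (u + v) ^+ 2; set P := a * (a + 1) => hE hm.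
have P2 : 2 <= P by rewrite /P; nra.
have m0 : 0 <= m by rewrite sqr_ge0.
have m2 : m < 1 / 2 by nra.
have uv0 : 0 <= u * v by rewrite mulr_ge0.
have uvm : 4 * (u * v) <= m by have := sqr_ge0 (u - v); rewrite /m; nra.
have g0 : 0 <= u * v * (2 - u * v * (2 + m)) * (s * t).
  by rewrite !mulr_ge0 // ?ltW //; nra.
have S1 : 2 + m <= (s + t) * (1 + m) by lra.
nra.
Qed.

(** The case [a >= 1 + s], where [a] may be less than 2: the last term of
[cot_sumE], at least [7/5 (1 - s)], compensates for the smaller [a]. *)
Lemma not_packs3_sum_gt_corner a s t :
    1 < a -> 1 + s <= a -> 0 < t -> t <= s -> s <= 1 ->
    ~ packs3 a s t (a + 1) ->
  13 / 7 + (1 - s) < s + t.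
Proof.
move=> a1 sa t0 ts s1 np.
have s0 : 0 < s by lra.
have t1 : t <= 1 by lra.
have [|u [v [[u0 v0] hs ht]]] := not_packs3_cot a s t _ s0 s1 t0 t1 np; first lra.
have := cot_sumE u v; rewrite /= -hs -ht.
have hs1 : s * (1 + u ^+ 2) = 1.
  by rewrite hs mulVf // gt_eqF // ltr_wpDr ?sqr_ge0.
have ht1 : t * (1 + v ^+ 2) = 1.
  by rewrite ht mulVf // gt_eqF // ltr_wpDr ?sqr_ge0.
clear hs ht.
have uv : u <= v.
  rewrite -ler_sqr ?nnegrE //; have := sqr_ge0 v; have := sqr_ge0 u; nra.
have um : 4 * u ^+ 2 <= (u + v) ^+ 2 by nra.
have vm : v ^+ 2 <= (u + v) ^+ 2 by nra.
have uvm : 4 * (u * v) <= (u + v) ^+ 2 by have := sqr_ge0 (u - v); nra.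
move: ((u + v) ^+ 2) um vm uvm => m um vm uvm hE hm.
have m0 : 0 <= m by have := sqr_ge0 u; lra.
have m2 : m < 1 / 2 by nra.
(* First localization: [4 u^2 <= m < 1/2], then [a >= 1 + s > 17/9], then
   [m < 5/27] and so [t > 27/32]. *)
have s89 : 8 / 9 < s by nra.
have P5 : 27 / 5 < a * (a + 1) by nra.
have m5 : m < 5 / 27 by nra.
have t27 : 27 / 32 < t by nra.
have e1 : 1 - s = u ^+ 2 * s by lra.
have gain : 7 / 5 * (1 - s) <= u * v * (2 - u * v * (2 + m)) * (s * t).
  have h1 : 168 / 100 <= 2 - u * v * (2 + m) by nra.
  have h2 : u ^+ 2 <= u * v by rewrite expr2 ler_wpM2l.
  have h3 : u ^+ 2 * (168 / 100) <= u * v * (2 - u * v * (2 + m)).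
    by apply: ler_pM => //; rewrite ?sqr_ge0 //; lra.
  have h4 : s * (27 / 32) <= s * t by rewrite ler_pM2l // ltW.
  have h5 : u ^+ 2 * (168 / 100) * (s * (27 / 32)) <=
      u * v * (2 - u * v * (2 + m)) * (s * t).
    by apply: ler_pM => //; [rewrite mulr_ge0 ?sqr_ge0 //; lra | lra].
  have := sqr_ge0 u; nra.
rewrite ltNge; apply/negP => hS.
(* With [e = 1 - s] and [P = a (a + 1) >= (2 - e) (3 - e)], the assumption [hS]
   bounds [m] from below, which contradicts [P m < 1]. *)
have hmP : (1 / 7 + 2 / 5 * (1 - s)) <= m * (6 / 7 + (1 - s)) by nra.
have P6 : 6 - 5 * (1 - s) <= a * (a + 1) by nra.
have e0 : 0 <= 1 - s by lra.
have e9 : 1 - s < 1 / 9 by lra.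
move: (1 - s : R) (a * (a + 1) : R) hmP P6 e0 e9 hm P5 => e P hmP P6 e0 e9 hm P5.
have hPm : P * m * (6 / 7 + e) < 6 / 7 + e.
  rewrite -[ltRHS]mul1r ltr_pM2r; lra.
have : P * (1 / 7 + 2 / 5 * e) <= P * (m * (6 / 7 + e)) by rewrite ler_pM2l //; lra.
nra.
Qed.

(** The disks of radii [a] and 1 span a diameter, which forces
[a c1 + c2 = 0] for their centres; Stewart's theorem for the third centre and
the segment from [c1] to [c2] then bounds [t]. *)
Lemma packs3_unit_le a t : 0 < a -> 0 < t ->
  packs3 a 1 t (a + 1) -> t * (1 + a * (a + 1)) <= a * (a + 1).
Proof.
move=> a0 t0 /packs3P[] // [x1 y1] [[x2 y2] [[x3 y3] [[h1 h2 h3] [k12 k13 k23]]]].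
have at1 : t <= a + 1 by have := eucl_dist_ge0 (0, 0) (x3, y3); lra.
move: h1 h2 h3 k12 k13 k23.
rewrite -3!lerBrDr !(eucl_dist_le, eucl_dist_ge) /=; [|lra..].
move=> h1 h2 h3 k12 k13 k23.
(* [|a c1 + c2|^2 = a (a + 1) |c1|^2 + (a + 1) |c2|^2 - a |c1 - c2|^2], where
   [|c1| <= 1], [|c2| <= a] and [|c1 - c2| >= a + 1]. *)
have c0 : (a * x1 + x2) ^+ 2 + (a * y1 + y2) ^+ 2 <= 0.
  have aa : 0 <= a * (a + 1) by nra.
  have a1 : 0 <= a + 1 by lra.
  have := ler_wpM2l aa h1; have := ler_wpM2l a1 h2.
  have := ler_wpM2l (ltW a0) k12; lra.
have X0 : a * x1 + x2 = 0.
  by apply/eqP; rewrite -sqrf_eq0; apply/eqP; have := sqr_ge0 (a * x1 + x2);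
     have := sqr_ge0 (a * y1 + y2); lra.
have Y0 : a * y1 + y2 = 0.
  by apply/eqP; rewrite -sqrf_eq0; apply/eqP; have := sqr_ge0 (a * x1 + x2);
     have := sqr_ge0 (a * y1 + y2); lra.
have stewart : a * ((x1 - x3) ^+ 2 + (y1 - y3) ^+ 2) +
    ((x2 - x3) ^+ 2 + (y2 - y3) ^+ 2) =
  (a + 1) * (x3 ^+ 2 + y3 ^+ 2) + a * (x1 ^+ 2 + y1 ^+ 2) + (x2 ^+ 2 + y2 ^+ 2)
    - 2 * (x3 * (a * x1 + x2) + y3 * (a * y1 + y2)) by ring.
rewrite X0 Y0 !mulr0 addr0 mulr0 subr0 in stewart.
have a1 : 0 <= a + 1 by lra.
have := ler_wpM2l (ltW a0) h1; have := ler_wpM2l a1 h3.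
have := ler_wpM2l (ltW a0) k13; lra.
Qed.

End Packing.

(** * Admissible triples near the corner *)

Section Template.
Context {R : realType}.
Implicit Types (a s w e d : R) (t : triple R).

Lemma admissible_rho_gt w t : admissible w t ->
  13 / 7 + (1 - sigma1 t) < rho t.
Proof.
case: t => [[a s] r]; rewrite /admissible /alpha /sigma1 /sigma2 /=.
move=> [[a1 wa [r0 rs s1]] [B1 B2 B4 W]].
rewrite /constraint_B1 /constraint_B2 /constraint_W /alpha /sigma1 /sigma2 /=
  in B1 B2 W.
rewrite /rho /alpha /sigma1 /sigma2 /= lt_max; apply/orP; left.
by apply: not_packs3_sum_gt_corner B1 => //; lra.
Qed.

(** By the sharp bound, [1 - s] and the excess of [s + r] over [13/7] are less
than [d], which leaves [r] and, through (B2) and (W), the lower bounds of [a]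
and [w] within [O(d)] of the corner.  The upper bound of [a] comes from
[not_packs3_sum_gt], whose lower bound for [s + r] increases with [a], and (W)
turns it into an upper bound of [w]. *)
Lemma admissible_near_corner w t d : admissible w t -> d <= 1 / 14 ->
    rho t <= 13 / 7 + d ->
  [/\ `|2 - alpha t| <= 20 * d, `|6 / 7 - sigma2 t| <= 20 * d
    & `|1 / 7 - w| <= 20 * d].
Proof.
move=> adm d14 hd; have := admissible_rho_gt w t adm.
move: adm hd; case: t => [[a s] r].
rewrite /admissible /rho /alpha /sigma1 /sigma2 /=.
move=> [[a1 wa [r0 rs s1]] [B1 B2 B4 W]].
rewrite /constraint_B1 /constraint_B2 /constraint_B4 /constraint_W
  /alpha /sigma1 /sigma2 /= in B1 B2 B4 W.
rewrite ge_max => /andP[hS _] hgt.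
have {}hgt : 13 / 7 + (1 - s) < s + r.
  by apply: not_packs3_sum_gt_corner B1 => //; lra.
have hP : 1 + 2 * (a * (a + 1)) < (s + r) * (1 + a * (a + 1)).
  by apply: not_packs3_sum_gt B1 => //; lra.
have a2 : a <= 2 + 20 * d.
  rewrite leNgt; apply/negP => ha.
  have P0 : 0 < 1 + a * (a + 1) by nra.
  have : 1 + 2 * (a * (a + 1)) < (13 / 7 + d) * (1 + a * (a + 1)).
    by apply: lt_le_trans hP _; rewrite ler_pM2r.
  have d0 : 0 < d by lra.
  have P6 : 6 + 100 * d <= a * (a + 1) by nra.
  have d7 : 0 <= 1 / 7 - d by lra.
  have := ler_wpM2l d7 P6; nra.
by split; rewrite ler_norml; apply/andP; split; lra.
Qed.

(** The critical radius [a (a + 1) / (1 + a (a + 1))] is [6/7] at [a = 2], and its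
slope there is [5/49 < 1]. *)
Lemma not_packs3_above_corner e : 0 < e ->
  ~ packs3 (2 + e) 1 (6 / 7 + e) (2 + e + 1).
Proof. by move=> e0 /packs3_unit_le; nra. Qed.

(** Here [u = 0], [v^2 = 1/6]: the packing condition is an equality. *)
Lemma packs3_corner : packs3 (2 : R) 1 (6 / 7) (2 + 1).
Proof.
have h : (0 : R) <= 6^-1 by rewrite invr_ge0.
by apply: (@packs3_of_cot R 2 1 (6 / 7) 0 (Num.sqrt 6^-1));
  rewrite ?sqr_sqrtr // ?add0r ?sqr_sqrtr //; lra.
Qed.

Lemma admissible_above_corner e : 0 < e -> e <= 1 / 7 ->
  admissible (1 / 7) (2 + e, 1, 6 / 7 + e).
Proof.
move=> e0 e7; rewrite /admissible /alpha /sigma1 /sigma2 /=.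
split; split; [lra|lra|by split; lra| |..];
  rewrite /constraint_B1 /constraint_B2 /constraint_B4 /constraint_W
    /alpha /sigma1 /sigma2 /=; [exact: not_packs3_above_corner | lra..].
Qed.

Lemma rho_above_corner e : 0 < e ->
  rho ((2 + e, 1, 6 / 7 + e) : triple R) = 13 / 7 + e.
Proof.
move=> e0; rewrite /rho /alpha /sigma1 /sigma2 /= max_l; first lra.
by rewrite ler_pdivrMr; nra.
Qed.

(** Division by 7 keeps [6/7 + eps n] at most 1, so that [sigma2 <= sigma1] holds
along the family [(2 + eps n, 1, 6/7 + eps n)]. *)
Definition eps (n : nat) : R := harmonic n / 7.

Lemma eps_gt0 n : 0 < eps n.
Proof. by rewrite divr_gt0 // harmonic_gt0. Qed.

Lemma eps_le n : eps n <= 1 / 7.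
Proof. by rewrite ler_pM2r ?invr_gt0 // invf_le1 // ler1n. Qed.

Lemma cvg_eps : eps @ \oo --> (0 : R).
Proof. by rewrite -(mul0r 7^-1); apply: cvgM; [exact: cvg_harmonic|exact: cvg_cst]. Qed.

Lemma cvg_corner (c d : R) :
  ((2 + c * eps n, 1, 6 / 7 + d * eps n) : triple R) @[n --> \oo]
    --> ((2, 1, 6 / 7) : triple R).
Proof.
have affine (x k : R) : (x + k * eps n) @[n --> \oo] --> x.
  rewrite -[in X in _ --> X](addr0 x) -(mulr0 k).
  by apply: cvgD; [exact: cvg_cst | apply: cvgM; [exact: cvg_cst|exact: cvg_eps]].
exact: (cvg_pair (cvg_pair (affine 2 c) (cvg_cst (1 : R))) (affine (6 / 7) d)).
Qed.

Lemma T_can_ge w : ((13 / 7)%:E <= T_can w)%E.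
Proof.
apply: le_ereal_inf_tmp => _ [t adm <-]; rewrite lee_fin.
have [[_ _ [_ _ s1]] _] := adm; have := admissible_rho_gt w t adm; lra.
Qed.

Lemma T_can_eq w : T_can w = (13 / 7)%:E <-> w = 1 / 7.
Proof.
split=> [Tw|->]; last first.
  apply/eqP; rewrite eq_le T_can_ge andbT.
  apply/lee_addgt0Pr => e e0.
  pose e' := Num.min e (1 / 7).
  have e'0 : 0 < e' by rewrite lt_min e0; lra.
  apply: le_trans (_ : (13 / 7 + e')%:E <= _)%E; last first.
    by rewrite -EFinD lee_fin lerD2l ge_min lexx.
  apply: ereal_inf_lbound; exists (2 + e', 1, 6 / 7 + e').
    by apply: admissible_above_corner; rewrite // ge_min lexx orbT.
  by rewrite rho_above_corner.
apply/eqP/negPn/negP => w7.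
have x0 : 0 < `|1 / 7 - w| by rewrite normr_gt0 subr_eq0 eq_sym.
pose d := Num.min (1 / 14) (`|1 / 7 - w| / 40).
have d0 : 0 < d by rewrite lt_min; apply/andP; split; lra.
have d14 : d <= 1 / 14 by rewrite ge_min lexx.
have dx : d <= `|1 / 7 - w| / 40 by rewrite ge_min lexx orbT.
have /ereal_inf_lt[_ [t adm <-]] : (T_can w < (13 / 7 + d)%:E)%E.
  by rewrite Tw lte_fin ltrDl.
rewrite lte_fin => /ltW hd.
have [_ _] := admissible_near_corner w t d adm d14 hd; lra.
Qed.

Lemma boundaryI (T : topologicalType) (A : set T) (f g : nat -> T) (x : T) :
    f @ \oo --> x -> g @ \oo --> x ->
    (forall n, A (f n)) -> (forall n, ~ A (g n)) ->
  boundary A x.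
Proof.
move=> fx gx Af Ag; split=> [B xB|xA].
  have : \forall n \near \oo, B (f n) by exact: fx.
  by move=> /filter_ex[n Bn]; exists (f n); split.
have : \forall n \near \oo, A (g n) by exact: gx.
by move=> /filter_ex[n /Ag].
Qed.

(** (B2), (B4) and (W) hold with equality at the corner and fail arbitrarily close
to it.  (B1) fails at the corner, which is packable, but holds at the triples
[(2 + e, 1, 6/7 + e)]. *)
Lemma corner_saturates : let corner : triple R := (2, 1, 6 / 7) in
   [/\ saturates constraint_B1 corner,
       saturates (constraint_B2 (1 / 7)) corner,
       saturates (constraint_B4 (1 / 7)) corner
     & saturates (constraint_W (1 / 7)) corner].
Proof.
have e0 := eps_gt0.
split.
- apply: boundaryI (cvg_corner 1 1) (cvg_corner 0 0) _ _ => n;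
    rewrite /constraint_B1 /alpha /sigma1 /sigma2 /=.
    by rewrite !mul1r; exact: not_packs3_above_corner.
  by rewrite !mul0r !addr0; apply; exact: packs3_corner.
- apply: boundaryI (cvg_corner 0 0) (cvg_corner 0 (-1)) _ _ => n;
    rewrite /constraint_B2 /sigma2 /=; first by lra.
  by have := e0 n; lra.
- apply: boundaryI (cvg_corner 0 0) (cvg_corner 0 (-1)) _ _ => n;
    rewrite /constraint_B4 /alpha /sigma2 /=; first by lra.
  by have := e0 n; lra.
- apply: boundaryI (cvg_corner 0 0) (cvg_corner 0 1) _ _ => n;
    rewrite /constraint_W /alpha /sigma1 /sigma2 /=; first by lra.
  by have := e0 n; lra.
Qed.

Lemma cvg_rho_above_corner : exists t : nat -> triple R,
  (forall n, admissible (1 / 7) (t n)) /\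
  rho (t n) @[n --> \oo] --> (13 / 7 : R).
Proof.
exists (fun n => (2 + eps n, 1, 6 / 7 + eps n)); split=> [n|].
  by apply: admissible_above_corner; [exact: eps_gt0 | exact: eps_le].
have lim : (13 / 7 + eps n) @[n --> \oo] --> (13 / 7 + 0 : R).
  by apply: cvgD; [exact: cvg_cst | exact: cvg_eps].
rewrite addr0 in lim; apply: cvg_trans lim; apply: near_eq_cvg.
by apply: nearW => n; rewrite rho_above_corner // eps_gt0.
Qed.

Lemma cvg_near_corner (I : Type) (F : set_system I) (FF : ProperFilter F)
    w (t : I -> triple R) :
    (forall i, admissible w (t i)) ->
    rho (t i) @[i --> F] --> (13 / 7 : R) ->
  alpha (t i) @[i --> F] --> (2 : R) /\ sigma2 (t i) @[i --> F] --> (6 / 7 : R).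
Proof.
move=> adm hrho.
have near e : 0 < e ->
    \forall i \near F, `|2 - alpha (t i)| < e /\ `|6 / 7 - sigma2 (t i)| < e.
  move=> e0; pose d := Num.min (1 / 14) (e / 40).
  have d0 : 0 < d by rewrite lt_min; apply/andP; split; lra.
  have d14 : d <= 1 / 14 by rewrite ge_min lexx.
  have de : d <= e / 40 by rewrite ge_min lexx orbT.
  have rd : 13 / 7 < 13 / 7 + d by rewrite ltrDl.
  have rho_lt : \forall i \near F, rho (t i) < 13 / 7 + d.
    by move: hrho => /cvgr_lt; apply.
  apply: filterS rho_lt => i /ltW hd.
  have [ha hs _] := admissible_near_corner w (t i) d (adm i) d14 hd.
  by split; lra.
split; apply/cvgrPdist_lt => e e0;
  by apply: filterS (near e e0) => i [].
Qed.

End Template.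

(** * The tribonacci constant *)

(** Existence is the intermediate value theorem on a short interval inside the
prescribed one.  Real roots are greater than 1, and the difference quotient of
[x^3 - x^2 - x] is positive there. *)
Lemma tribonacci_root (R : realType) : exists T : R,
  unique (fun x : R => x ^+ 3 = x ^+ 2 + x + 1) T /\
  (17 + 856 / 10 ^+ 3) / 10 ^+ 3 <= 13 / 7 - T
    < (17 + 857 / 10 ^+ 3) / 10 ^+ 3.
Proof.
pose f (x : R) := x ^+ 3 - x ^+ 2 - x.
have root_gt1 (x : R) : x ^+ 3 = x ^+ 2 + x + 1 -> 1 < x.
  move=> hx; have x0 : 0 < x.
    rewrite ltNge; apply/negP => xn.
    by have := sqr_ge0 x; have := sqr_ge0 (x + 1); nra.
  by rewrite ltNge; apply/negP => xn; nra.
pose lo : R := 13 / 7 - (17 + (856 + 9 / 10) / 10 ^+ 3) / 10 ^+ 3.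
pose hi : R := 13 / 7 - (17 + 856 / 10 ^+ 3) / 10 ^+ 3.
have lohi : lo <= hi by rewrite /lo /hi; lra.
have flo : f lo <= 1 by rewrite /f /lo; lra.
have fhi : 1 <= f hi by rewrite /f /hi; lra.
have cf : {within `[lo, hi], continuous f}.
  apply: continuous_subspaceT => x.
  apply: cvgB; last exact: cvg_id.
  by apply: cvgB; exact: exprn_continuous.
have mid : Num.min (f lo) (f hi) <= 1 <= Num.max (f lo) (f hi).
  by rewrite ge_min flo le_max fhi orbT.
have [T] := IVT lohi cf mid; rewrite in_itv /= => /andP[Tlo Thi] fT.
have rT : T ^+ 3 = T ^+ 2 + T + 1 by rewrite -fT /f; ring.
exists T; split; last first.
  by move: Tlo Thi; rewrite /lo /hi => Tlo Thi; apply/andP; split; lra.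
split=> // x rx; have T1 := root_gt1 T rT; have x1 := root_gt1 x rx.
apply/eqP; rewrite -subr_eq0; apply/eqP.
have : (T - x) * (T ^+ 2 + T * x + x ^+ 2 - T - x - 1) = 0.
  transitivity ((T ^+ 3 - T ^+ 2 - T) - (x ^+ 3 - x ^+ 2 - x)); first by ring.
  by rewrite rT rx; ring.
by move/eqP; rewrite mulf_eq0 => /orP[/eqP //|/eqP]; nra.
Qed.

(** * The lower bound and its equality case *)

Theorem theorem30 (R : realType) :
  (exists T : R,
     unique (fun x : R => x ^+ 3 = x ^+ 2 + x + 1) T /\
     (17 + 856 / 10 ^+ 3) / 10 ^+ 3 <= 13 / 7 - T
       < (17 + 857 / 10 ^+ 3) / 10 ^+ 3) /\
  (forall w : R, 0 < w -> ((13 / 7)%:E <= T_can w)%E) /\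
  (forall w : R, 0 < w -> (T_can w = (13 / 7)%:E <-> w = 1 / 7)) /\
  (forall (w : R) (t : triple R),
     0 < w -> admissible w t -> rho t <> 13 / 7) /\
  (let corner : triple R := (2, 1, 6 / 7) in
   [/\ saturates constraint_B1 corner,
       saturates (constraint_B2 (1 / 7)) corner,
       saturates (constraint_B4 (1 / 7)) corner
     & saturates (constraint_W (1 / 7)) corner]) /\
  (exists t : nat -> triple R,
     (forall n, admissible (1 / 7) (t n)) /\
     rho (t n) @[n --> \oo] --> (13 / 7 : R)) /\
  (forall (I : Type) (F : set_system I) (FF : ProperFilter F)
     (t : I -> triple R),
     (forall i, admissible (1 / 7) (t i)) ->
     rho (t i) @[i --> F] --> (13 / 7 : R) ->
     alpha (t i) @[i --> F] --> (2 : R) /\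
     sigma2 (t i) @[i --> F] --> (6 / 7 : R)).
Proof.
split; first exact: tribonacci_root.
split=> [w _|]; first exact: T_can_ge.
split=> [w _|]; first exact: T_can_eq.
split=> [w t _ adm|].
  have [[_ _ [_ _ s1]] _] := adm.
  by have := admissible_rho_gt w t adm => + eq_rho; rewrite eq_rho; lra.
split; first exact: corner_saturates.
split; first exact: cvg_rho_above_corner.
by move=> I F FF t; exact: cvg_near_corner.
Qed.
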